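(* Let $(x^*,y^*,s^* )$ be an optimal solution of the convex quadratic programming pair (QP) with data $(H,A,b,c)$. Then there exist a positive constant $\hat\lambda=\hat\lambda(H,A,b,c,x^*,s^* )$ and a positive constant $C_1=C_1(H,A,x^*,s^* )$ such that for every $\lambda\in\mathbb{R}^n$ with $\lambda\ge 0$ and $0<\|\lambda\|<\hat\lambda$ there is a triple $(x,y,s)\in\mathbb{R}^n\times\mathbb{R}^m\times\mathbb{R}^n$ satisfying $$(x_i+\lambda_i)(s_i+\lambda_i)=0\quad (i=1,\dots,n),\qquad x+\lambda\ge 0,\qquad s+\lambda\ge 0,$$ such that $$\mathcal{A}_\lambda(x)=\mathcal{A}(x^* ),\quad \mathcal{I}_\lambda(x)=\mathcal{I}(x^* ),\quad \mathcal{A}^s_\lambda(s)=\mathcal{A}^s(s^* ),\quad \mathcal{S}_\lambda(s)=\mathcal{S}(s^* ),$$ and $$\max\left(\|Ax-b\|,\ \|A^Ty+s-Hx-c\|\right)<C_1\|\lambda\|.$$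
   Context: Let $H\in\mathbb{R}^{n\times n}$ be symmetric positive semidefinite, $A\in\mathbb{R}^{m\times n}$ with $m\le n$, $b\in\mathbb{R}^m$, $c\in\mathbb{R}^n$. Vector inequalities are componentwise and $\|\cdot\|$ is the Euclidean norm. The pair (QP) consists of the primal problem $\min_x \frac12x^THx+c^Tx$ subject to $Ax=b$, $x\ge0$, and the dual problem $\max_{(x,y,s)} b^Ty-\frac12x^THx$ subject to $A^Ty+s-Hx=c$, $s\ge0$, $y$ free. A triple $(x^*,y^*,s^* )\in\mathbb{R}^n\times\mathbb{R}^m\times\mathbb{R}^n$ is an optimal solution of (QP) if and only if $Ax^*=b$, $A^Ty^*+s^*-Hx^*=c$, $x^*\ge0$, $s^*\ge0$ and $x_i^*s_i^*=0$ for all $i$. For an optimal solution $(x^*,y^*,s^* )$ of (QP), with $i$ ranging over $\{1,\dots,n\}$: $\mathcal{A}(x^* )=\{i: x_i^*=0\}$, $\mathcal{I}(x^* )=\{i: x_i^*>0\}$, $\mathcal{A}^s(s^* )=\{i: s_i^*=0\}$, $\mathcal{S}(s^* )=\{i: s_i^*>0\}$. For $\lambda\ge 0$ and a triple $(x,y,s)$: $\mathcal{A}_\lambda(x)=\{i: x_i=-\lambda_i\}$, $\mathcal{I}_\lambda(x)=\{i: x_i>-\lambda_i\}$, $\mathcal{A}^s_\lambda(s)=\{i: s_i=-\lambda_i\}$, $\mathcal{S}_\lambda(s)=\{i: s_i>-\lambda_i\}$. *)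

(* Defs.v *)
From mathcomp Require Import all_boot all_order all_algebra.
From mathcomp Require Import reals.

Set Implicit Arguments.
Unset Strict Implicit.
Unset Printing Implicit Defensive.

Import Order.TTheory GRing.Theory Num.Theory.
Local Open Scope ring_scope.

Section Vectors.
Variables (R : realType) (n : nat).
Implicit Types (u v : 'cV[R]_n) (H : 'M[R]_n).

Definition dot u v : R := (u^T *m v) 0 0.

(* The norm that MathComp-Analysis puts on matrices is the sup norm, so it
   is not used here. *)
Definition enorm v : R := Num.sqrt (\sum_i v i 0 ^+ 2).

Definition nonneg v : Prop := forall i, 0 <= v i 0.

Definition psd H : Prop := forall v, 0 <= dot v (H *m v).

End Vectors.

Section QP.
Variables (R : realType) (m n : nat).
Variables (H : 'M[R]_n) (A : 'M[R]_(m, n)) (b : 'cV[R]_m) (c : 'cV[R]_n).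
Implicit Types (x s : 'cV[R]_n) (y : 'cV[R]_m).

Definition primal_obj x : R := 2%:R^-1 * dot x (H *m x) + dot c x.

Definition primal_feasible x : Prop := A *m x = b /\ nonneg x.

Definition primal_optimal x : Prop :=
  primal_feasible x /\
  forall x', primal_feasible x' -> primal_obj x <= primal_obj x'.

(* In the dual problem x is a free variable: it need be neither nonnegative
   nor primal feasible. *)
Definition dual_obj x y : R := dot b y - 2%:R^-1 * dot x (H *m x).

Definition dual_feasible x y s : Prop :=
  A^T *m y + s - H *m x = c /\ nonneg s.

Definition dual_optimal x y s : Prop :=
  dual_feasible x y s /\
  forall x' y' s', dual_feasible x' y' s' -> dual_obj x' y' <= dual_obj x y.

(* The same x solves both problems.  For H symmetric positive semidefinite,
   convex QP duality makes this equivalent to primal feasibility, dual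
   feasibility and x_i s_i = 0 for all i. *)
Definition qp_optimal x y s : Prop := primal_optimal x /\ dual_optimal x y s.

End QP.

Section IndexSets.
Variables (R : realType) (n : nat).
Implicit Types v l : 'cV[R]_n.

(* Applied to x these are the sets A(x) and I(x), applied to s the sets
   A^s(s) and S(s). *)
Definition zero_set v : {set 'I_n} := [set i | v i 0 == 0].
Definition pos_set v : {set 'I_n} := [set i | 0 < v i 0].

(* Likewise A_l(x), I_l(x) and A^s_l(s), S_l(s). *)
Definition zero_set_pert l v : {set 'I_n} := [set i | v i 0 == - l i 0].
Definition pos_set_pert l v : {set 'I_n} := [set i | - l i 0 < v i 0].

End IndexSets.

(* Main.v *)
Require Import Defs.
From mathcomp Require Import all_boot all_order all_algebra.
From mathcomp Require Import reals boolp ring lra.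

Set Implicit Arguments.
Unset Strict Implicit.
Unset Printing Implicit Defensive.

Import Order.TTheory GRing.Theory Num.Theory.
Local Open Scope ring_scope.

(** Shifting an optimal (x, y, s) to (x - lambda, y, s - lambda) turns
    complementarity and the index sets at lambda into those of (x, y, s), and
    the residuals become - A lambda and (H - 1) lambda, so any lambda_hat
    works.  What remains is that the optimal x and s are complementary:
    Farkas' lemma, applied to the cone of feasible directions at x, gives a
    dual feasible (x, y', s') with no duality gap, and the gap of a dual
    feasible (x, y, s) is the inner product of x and s. *)

(* Induction on the number of rows (Bartl): if d is a direction violating the
   conclusion for the remaining rows, then the first row a is negative at d,
   and the induction hypothesis is applied after projecting along d onto the
   kernel of a. *)
Lemma farkas (R : realFieldType) (n k : nat) (M : 'M[R]_(k, n)) (g : 'rV[R]_n) :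
  (forall d : 'cV[R]_n, (forall i, 0 <= (M *m d) i 0) -> 0 <= (g *m d) 0 0) ->
  exists2 l : 'rV[R]_k, forall i, 0 <= l 0 i & g = l *m M.
Proof.
elim: k => [|k IHk] in M g *.
  (* With no rows every direction is admissible; testing [- g^T] bounds the sum of the squares of
     [g] by 0, so [g] vanishes. *)
  move=> gP; exists 0 => [[]//|]; rewrite mul0mx.
  have : 0 <= (g *m - g^T) 0 0 by apply: gP => -[].
  rewrite mulmxN !mxE oppr_ge0 => g2_le0.
  have g2_ge0 i : true -> 0 <= g 0 i * g^T i 0 by rewrite mxE -expr2 sqr_ge0.
  have /psumr_eq0P g2 : \sum_i g 0 i * g^T i 0 = 0.
    by apply/eqP; rewrite eq_le g2_le0 sumr_ge0.
  apply/rowP => i; apply/eqP; rewrite mxE -sqrf_eq0 expr2.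
  by have := g2 g2_ge0 i isT; rewrite mxE => ->.
move: M; rewrite -[k.+1]/(1 + k)%N => M.
rewrite -[M]vsubmxK; move: (usubmx M) (dsubmx M) => a N {M} gP.
have [/IHk[l l_ge0 ->]|] := pselect (forall d : 'cV[R]_n,
    (forall i, 0 <= (N *m d) i 0) -> 0 <= (g *m d) 0 0).
  exists (row_mx 0 l); last by rewrite mul_row_col mul0mx add0r.
  by move=> i; rewrite mxE; case: split => j; rewrite ?mxE.
move=> /existsNP[d /not_implyP[Nd /negP]]; rewrite -ltNge => gd.
have ad : (a *m d) 0 0 < 0.
  rewrite ltNge; apply/negP => ad; have := gP d; rewrite leNgt gd => /(_ _)/notF[]//.
  by move=> i; rewrite mul_col_mx mxE; case: split => j; rewrite ?ord1.
set t := (a *m d) 0 0 in ad.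
have ti : t^-1 < 0 by rewrite invr_lt0.
pose P : 'M[R]_n := 1%:M - t^-1 *: (d *m a).
have aP : a *m P = 0.
  rewrite /P mulmxBr mulmx1 -scalemxAr mulmxA [a *m d]mx11_scalar -/t.
  by rewrite mul_scalar_mx scalerA mulVf ?scale1r ?subrr // lt_eqF.
have [|l l_ge0 gl] := IHk (N *m P) (g *m P).
  move=> e Ne; rewrite -mulmxA; apply: gP => i.
  rewrite mul_col_mx mxE; case: split => j; last by rewrite mulmxA.
  by rewrite mulmxA aP mul0mx mxE.
have Pexp k' (B : 'M[R]_(k', n)) : B = B *m P + t^-1 *: (B *m d) *m a.
  by rewrite /P mulmxBr mulmx1 -scalemxAr mulmxA scalemxAl subrK.
(* Expanding [g] and [N] by [Pexp] and collecting the multiples of [a] in [g *m P = l *m (N *m P)]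
   yields this weight for [a]. It is nonnegative because [t] and [g *m d] are negative while [l] and
   [N *m d] are nonnegative. *)
exists (row_mx (t^-1 *: (g *m d - l *m (N *m d))) l).
  move=> i; rewrite mxE; case: split => j //.
  rewrite ord1 mxE mulr_le0 ?(ltW ti) // mxE [in X in _ + X]mxE.
  rewrite subr_le0 (le_trans (ltW gd)) // mxE.
  by apply: sumr_ge0 => i' _; rewrite mulr_ge0.
rewrite mul_row_col [LHS]Pexp gl [in X in _ = _ + X](Pexp _ N).
rewrite mulmxDr scalerBr mulmxBl -!scalemxAl -!scalemxAr !mulmxA.
by rewrite [RHS]addrCA subrK.
Qed.

Section Dot.
Variables (R : realType) (n : nat).
Implicit Types u v w : 'cV[R]_n.

Lemma dotE u v : dot u v = \sum_i u i 0 * v i 0.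
Proof. by rewrite /dot mxE; apply: eq_bigr => i _; rewrite mxE. Qed.

Lemma dotC u v : dot u v = dot v u.
Proof. by rewrite !dotE; apply: eq_bigr => i _; rewrite mulrC. Qed.

Lemma dotDr u v w : dot u (v + w) = dot u v + dot u w.
Proof. by rewrite /dot mulmxDr mxE. Qed.

Lemma dotDl u v w : dot (u + v) w = dot u w + dot v w.
Proof. by rewrite dotC dotDr !(dotC w). Qed.

Lemma dotZr a u v : dot u (a *: v) = a * dot u v.
Proof. by rewrite /dot -scalemxAr mxE. Qed.

Lemma dotZl a u v : dot (a *: u) v = a * dot u v.
Proof. by rewrite dotC dotZr dotC. Qed.

Lemma dot_mulmx k (M : 'M[R]_(k, n)) (w : 'cV[R]_k) u :
  dot (M *m u) w = dot u (M^T *m w).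
Proof. by rewrite /dot trmx_mul mulmxA. Qed.

Lemma dot_nonneg_eq0 u v :
  nonneg u -> nonneg v -> dot u v <= 0 -> forall i, u i 0 * v i 0 = 0.
Proof.
move=> u_ge0 v_ge0; rewrite dotE => uv_le0 i.
have uv_ge0 j : true -> 0 <= u j 0 * v j 0 by move=> _; rewrite mulr_ge0.
apply: (psumr_eq0P uv_ge0) => //; apply/eqP.
by rewrite eq_le uv_le0 sumr_ge0.
Qed.

End Dot.

Section Norm.
Variable R : realType.

Lemma normr_le_enorm n (v : 'cV[R]_n) i : `|v i 0| <= enorm v.
Proof.
rewrite -sqrtr_sqr ler_wsqrtr // (bigD1 i) //= lerDl.
by apply: sumr_ge0 => j _; rewrite sqr_ge0.
Qed.

Lemma enorm_le_sum n (v : 'cV[R]_n) : enorm v <= \sum_i `|v i 0|.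
Proof.
have S_ge0 : 0 <= \sum_i `|v i 0| by apply: sumr_ge0.
rewrite -(ger0_norm S_ge0) -sqrtr_sqr ler_wsqrtr // expr2 mulr_suml.
apply: ler_sum => i _; rewrite -real_normK ?num_real // expr2.
rewrite ler_wpM2l // (bigD1 i) //= lerDl; exact: sumr_ge0.
Qed.

Lemma enorm_mulmx_le k n (M : 'M[R]_(k, n)) (v : 'cV[R]_n) :
  enorm (M *m v) <= (\sum_i \sum_j `|M i j|) * enorm v.
Proof.
apply: le_trans (enorm_le_sum _) _; rewrite mulr_suml; apply: ler_sum => i _.
rewrite mxE mulr_suml; apply: le_trans (ler_norm_sum _ _ _) _.
by apply: ler_sum => j _; rewrite normrM ler_wpM2l // normr_le_enorm.
Qed.

End Norm.

Section Optimality.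
Variables (R : realType) (m n : nat).
Variables (H : 'M[R]_n) (A : 'M[R]_(m, n)) (b : 'cV[R]_m) (c : 'cV[R]_n).
Implicit Types (x s d : 'cV[R]_n) (y : 'cV[R]_m).

Lemma primal_obj_line x d t : H^T = H ->
  primal_obj H c (x + t *: d) =
  primal_obj H c x + t * (dot (H *m x + c) d + 2%:R^-1 * t * dot d (H *m d)).
Proof.
move=> Hs; rewrite /primal_obj mulmxDr -scalemxAr.
rewrite !(dotDl, dotDr, dotZl, dotZr) -[dot x (H *m d)]dotC !dot_mulmx Hs.
rewrite [dot d (H *m x)]dotC dot_mulmx Hs; lra.
Qed.

(** Along a direction of negative slope, a short enough step would stay feasible and lower the
    objective, the quadratic term being of second order. *)
Lemma feasible_direction_ge0 x d : H^T = H -> psd H ->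
  primal_optimal H A b c x -> A *m d = 0 ->
  (forall i, x i 0 = 0 -> 0 <= d i 0) -> 0 <= dot (H *m x + c) d.
Proof.
move=> Hs Hp [[Ax x_ge0] x_opt] Ad d_ge0; rewrite leNgt; apply/negP => gd.
set g := dot _ d in gd; set q := dot d (H *m d).
have q_ge0 : 0 <= q by apply: Hp.
(* Indices with x i 0 = 0 contribute 0 to the sum, since 0^-1 = 0. *)
pose S : R := \sum_i `|d i 0| / x i 0.
have S_ge0 : 0 <= S by apply: sumr_ge0 => i _; rewrite divr_ge0.
have qg_ge0 : 0 <= q / - g by rewrite divr_ge0 // oppr_ge0 ltW.
(* The step length is [K^-1]. The summand [S] keeps the step feasible at the indices with positive
   [x i 0]; [q / - g] makes the curvature term cancel at most half of the slope [g]; 1 makes [K]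
   positive. *)
pose K := 1 + S + q / - g.
have K_gt0 : 0 < K by rewrite /K; lra.
have t_gt0 : 0 < K^-1 by rewrite invr_gt0.
have feas : primal_feasible A b (x + K^-1 *: d).
  split=> [|i]; first by rewrite mulmxDr -scalemxAr Ad scaler0 addr0.
  rewrite !mxE; have [xi0|xi] := eqVneq (x i 0) 0.
    by rewrite xi0 add0r mulr_ge0 ?d_ge0 // ltW.
  have xi_gt0 : 0 < x i 0 by rewrite lt_def xi x_ge0.
  have dS : `|d i 0| / x i 0 <= S.
    by rewrite /S (bigD1 i) //= lerDl sumr_ge0 // => j _; rewrite divr_ge0.
  have dK : `|d i 0| <= K * x i 0.
    by rewrite -ler_pdivrMr //; apply: le_trans dS _; rewrite /K; lra.
  have : `|d i 0| / K <= x i 0 by rewrite ler_pdivrMr // mulrC.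
  have : - `|d i 0| / K <= d i 0 / K.
    by rewrite ler_pM2r // lerNl -normrN ler_norm.
  by rewrite [K^-1 * _]mulrC mulNr; lra.
have := x_opt _ feas; rewrite primal_obj_line // lerDl pmulr_rge0 // -/g -/q.
have : q / K <= - g.
  rewrite ler_pdivrMr // -[leLHS](@divfK _ (- g)) ?oppr_eq0 ?lt_eqF //.
  by rewrite mulrC ler_pM2l ?oppr_gt0 // /K; lra.
by rewrite -[X in _ + X]mulrA [K^-1 * _]mulrC; lra.
Qed.

Lemma primal_optimal_kkt x : H^T = H -> psd H -> primal_optimal H A b c x ->
  exists y s, dual_feasible H A c x y s /\ dot x s = 0.
Proof.
move=> Hs Hp x_opt.
(* [E] keeps the sign constraints active at [x]; its other rows are zero and impose nothing on [d].
   The pair [A], [- A] encodes the equation [A *m d = 0]. *)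
pose E : 'M[R]_n := diag_mx (\row_i (x i 0 == 0)%:R).
have [d|l l_ge0 gl] :=
    @farkas R n _ (col_mx (col_mx A (- A)) E) (H *m x + c)^T.
  move=> Md; apply: (feasible_direction_ge0 (d := d) Hs Hp x_opt).
    apply/colP => i; apply/eqP; rewrite [X in _ == X]mxE eq_le.
    have := Md (lshift n (rshift m i)); have := Md (lshift n (lshift m i)).
    rewrite !mul_col_mx !col_mxEu col_mxEd mulNmx => ->.
    by rewrite mxE oppr_ge0 => ->.
  move=> i xi; have := Md (rshift _ i).
  by rewrite mul_col_mx col_mxEd mul_diag_mx !mxE xi eqxx mul1r.
rewrite -[l]hsubmxK -[lsubmx l]hsubmxK !mul_row_col mulmxN -mulmxBl in gl.
(* The free [y] is the difference of the multipliers of [A] and [- A]; the factor [E] makes [s]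
   vanish wherever [x] does not. *)
exists (lsubmx (lsubmx l) - rsubmx (lsubmx l))^T, (rsubmx l *m E)^T.
split; first split.
- by rewrite -trmx_mul -linearD /= -gl trmxK addrC addKr.
- by move=> i; rewrite mxE mul_mx_diag !mxE mulr_ge0 // ler0n.
rewrite dotE big1 // => i _; rewrite mxE mul_mx_diag !mxE.
by case: eqP => [->|_]; rewrite ?mul0r // mulr0 mulr0.
Qed.

(** Substituting [A *m x] for [b] and the dual equation for [c] makes the terms in [y] cancel. *)
Lemma dual_obj_gap x y s : A *m x = b -> dual_feasible H A c x y s ->
  dual_obj H b x y = primal_obj H c x - dot x s.
Proof.
move=> Ax [cE _]; rewrite /dual_obj /primal_obj -Ax dot_mulmx -cE.
rewrite [dot (_ - _) x]dotC !dotDr -scaleN1r dotZr; lra.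
Qed.

Lemma qp_optimal_complementary x y s : H^T = H -> psd H ->
  qp_optimal H A b c x y s -> forall i, x i 0 * s i 0 = 0.
Proof.
move=> Hs Hp [x_opt [ys_feas ys_opt]].
have [[Ax x_ge0] _] := x_opt.
apply: dot_nonneg_eq0 => //; first by case: ys_feas.
have [y' [s' [feas xs']]] := primal_optimal_kkt Hs Hp x_opt.
(* Both dual points share [x], so comparing their objectives compares only their gaps: [dot x s] is
   at most [dot x s'], which is 0. *)
have := ys_opt _ _ _ feas.
by rewrite (dual_obj_gap Ax feas) (dual_obj_gap Ax ys_feas) xs'; lra.
Qed.

End Optimality.

Lemma zero_set_pert_sub (R : realType) (n : nat) (l v : 'cV[R]_n) :
  zero_set_pert l (v - l) = zero_set v.
Proof. by apply/setP => i; rewrite !inE !mxE -subr_eq0 opprK subrK. Qed.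

Lemma pos_set_pert_sub (R : realType) (n : nat) (l v : 'cV[R]_n) :
  pos_set_pert l (v - l) = pos_set v.
Proof. by apply/setP => i; rewrite !inE !mxE ltrDr. Qed.

Theorem theorem3 (R : realType) (m n : nat) (le_mn : (m <= n)%N)
    (H : 'M[R]_n) (A : 'M[R]_(m, n))
    (H_sym : H^T = H) (H_psd : psd H)
    (xstar sstar : 'cV[R]_n) :
  exists C1 : R, 0 < C1 /\
  forall (b : 'cV[R]_m) (c : 'cV[R]_n),
  exists lambda_hat : R, 0 < lambda_hat /\
  forall ystar : 'cV[R]_m, qp_optimal H A b c xstar ystar sstar ->
  forall lambda : 'cV[R]_n, nonneg lambda ->
    0 < enorm lambda -> enorm lambda < lambda_hat ->
  exists (x : 'cV[R]_n) (y : 'cV[R]_m) (s : 'cV[R]_n),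
    [/\ forall i, (x i 0 + lambda i 0) * (s i 0 + lambda i 0) = 0,
        nonneg (x + lambda) & nonneg (s + lambda)] /\
    [/\ zero_set_pert lambda x = zero_set xstar,
        pos_set_pert lambda x = pos_set xstar,
        zero_set_pert lambda s = zero_set sstar
      & pos_set_pert lambda s = pos_set sstar] /\
    Num.max (enorm (A *m x - b)) (enorm (A^T *m y + s - H *m x - c))
      < C1 * enorm lambda.
Proof.
pose N k (M : 'M[R]_(k, n)) : R := \sum_i \sum_j `|M i j|.
have N_ge0 k (M : 'M[R]_(k, n)) : 0 <= N k M.
  by apply: sumr_ge0 => i _; apply: sumr_ge0.
(* Each residual is a matrix applied to [lambda], bounded through the sum [N] of absolute entries;
   the summand 1 makes the constant positive and the final bound strict. *)
exists (1 + N _ (- A) + N _ (H - 1%:M)); split.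
  by have := N_ge0 _ (- A); have := N_ge0 _ (H - 1%:M); lra.
move=> b c; exists 1; split=> // y opt lambda _ l_gt0 _.
have comp := qp_optimal_complementary H_sym H_psd opt.
have [[[Ax x_ge0] _] [[cE s_ge0] _]] := opt.
exists (xstar - lambda), y, (sstar - lambda); rewrite !subrK.
split; first by split=> // i; rewrite !mxE !subrK.
split; first by rewrite !zero_set_pert_sub !pos_set_pert_sub.
have -> : A *m (xstar - lambda) - b = - A *m lambda.
  by rewrite mulmxBr Ax addrAC subrr add0r mulNmx.
have -> : A^T *m y + (sstar - lambda) - H *m (xstar - lambda) - c =
    (H - 1%:M) *m lambda.
  rewrite -cE mulmxBr mulmxBl mul1mx; apply/colP => i; rewrite !mxE; ring.
rewrite gt_max; apply/andP; split; apply: le_lt_trans (enorm_mulmx_le _ _) _;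
  rewrite ltr_pM2r // -/(N _ _).
  by have := N_ge0 _ (H - 1%:M); lra.
by have := N_ge0 _ (- A); lra.
Qed.
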